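(* Let $W\in\mathbb{R}^{N\times N}$ be symmetric positive definite. (Direct updates.) Let $B,B_0\in\mathbb{R}^{N\times N}$ be symmetric, let $S=[s_1,\dots,s_M]\in\mathbb{R}^{N\times M}$ have rank $M$, and let $Y=[y_1,\dots,y_M]=BS$. If the Gram matrix $S^{\top}WS$ is diagonal, then the matrix $B_M$ obtained from $B_0$ by the $M$ repeated rank-2 updates $$ B_{i} = B_{i-1} + \frac{(y_i-B_{i-1}s_i)c_i^{\top} + c_i(y_i-B_{i-1}s_i)^{\top}}{c_i^{\top} s_i} - \frac{c_i\, s_i^{\top}(y_i-B_{i-1}s_i)\, c_i^{\top}}{(c_i^{\top} s_i)^2},\qquad c_i=Ws_i,\quad i=1,\dots,M, $$ equals the posterior mean under exact Gaussian inference from $(Y,S)$ with prior mean $B_0$ and prior covariance $W\circledast W$. (Inverse updates.) Equivalently, let $H,H_0\in\mathbb{R}^{N\times N}$ be symmetric, let $Y=[y_1,\dots,y_M]\in\mathbb{R}^{N\times M}$ have rank $M$, and let $S=[s_1,\dots,s_M]=HY$. If $Y^{\top}WY$ is diagonal, then the matrix $H_M$ obtained from $H_0$ by the $M$ repeated updates $$ H_{i} = H_{i-1} + \frac{(s_i-H_{i-1}y_i)c_i^{\top} + c_i(s_i-H_{i-1}y_i)^{\top}}{c_i^{\top} y_i} - \frac{c_i\, y_i^{\top}(s_i-H_{i-1}y_i)\, c_i^{\top}}{(c_i^{\top} y_i)^2},\qquad c_i=Wy_i,\quad i=1,\dots,M, $$ equals the posterior mean under exact Gaussian inference on $H$ from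 the observations $S=HY$ with prior mean $H_0$ and prior covariance $W\circledast W$.
   Context: For $A\in\mathbb{R}^{N\times N}$, $\mathrm{vec}(A)\in\mathbb{R}^{N^2}$ is the vector of its elements, $\mathrm{vec}(A)_{(ij)}=A_{ij}$. For symmetric $A$, $A\circledast A$ is the $N^2\times N^2$ matrix with elements $(A\circledast A)_{(ij),(k\ell)}=\tfrac12(A_{ik}A_{j\ell}+A_{jk}A_{i\ell})$. Exact Gaussian inference from $(Y,S)$ with prior mean $B_0$ and prior covariance $W\circledast W$ means: a random symmetric matrix $X$ has prior $\mathrm{vec}(X)\sim\mathcal{N}(\mathrm{vec}(B_0),W\circledast W)$ and is conditioned on the noise-free observation $XS=Y$. The posterior mean is $$ B_0 + \Delta(S^{\top} W S)^{-1}S^{\top} W + WS(S^{\top} W S)^{-1}\Delta^{\top} - WS(S^{\top} W S)^{-1}(S^{\top}\Delta)(S^{\top} W S)^{-1}S^{\top} W,\qquad \Delta=Y-B_0S. $$ For inference on $H$, the same formula holds with $S\leftrightarrow Y$ exchanged and $B_0$ replaced by $H_0$. *)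

(* Defs.v *)
From HB Require Import structures.
From mathcomp Require Import all_boot all_order all_algebra.
From mathcomp Require Import all_classical all_reals all_analysis.

Set Implicit Arguments.
Unset Strict Implicit.
Unset Printing Implicit Defensive.

Import Order.TTheory GRing.Theory Num.Theory.
Import numFieldNormedType.Exports.

Local Open Scope classical_set_scope.
Local Open Scope ring_scope.

Section linear_algebra.
Context {R : realType}.

Definition posdefmx n (A : 'M[R]_n) :=
  forall x : 'cV[R]_n, x != 0 -> 0 < (x^T *m A *m x) 0 0.

(* The inverse of [uncurry mxvec_index]: p stands for the double index (ij). *)
Definition mxvec_unindex m n (p : 'I_(m * n)) : 'I_m * 'I_n :=
  enum_val (cast_ord (esym (mxvec_cast m n)) p).

Lemma mxvec_indexK m n (i : 'I_m) (j : 'I_n) :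
  mxvec_unindex (mxvec_index i j) = (i, j).
Proof. by rewrite /mxvec_unindex cast_ordK enum_rankK. Qed.

(* Indexed so as to act on the vectorization [mxvec]. *)
Definition symkron n (A : 'M[R]_n) : 'M[R]_(n * n) :=
  \matrix_(p, q)
    let: (i, j) := mxvec_unindex p in let: (k, l) := mxvec_unindex q in
    2^-1 * (A i k * A j l + A j k * A i l).

Lemma symkronE n (A : 'M[R]_n) (i j k l : 'I_n) :
  symkron A (mxvec_index i j) (mxvec_index k l) =
  2^-1 * (A i k * A j l + A j k * A i l).
Proof. by rewrite mxE !mxvec_indexK. Qed.

Definition rank2_update n (W : 'M[R]_n) (s y : 'cV[R]_n) (B : 'M[R]_n) :=
  let c := W *m s in
  let r := y - B *m s in
  let cs := (c^T *m s) 0 0 in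
  B + cs^-1 *: (r *m c^T + c *m r^T)
    - (cs ^+ 2)^-1 *: (c *m (s^T *m r) *m c^T).

(* The update is applied for the columns 1, ..., M in increasing order. *)
Definition rank2_updates n M (W : 'M[R]_n) (S Y : 'M[R]_(n, M)) (B0 : 'M[R]_n) :=
  foldl (fun B i => rank2_update W (col i S) (col i Y) B) B0 (enum 'I_M).

Definition posterior_mean_formula n M (W B0 : 'M[R]_n) (S Y : 'M[R]_(n, M)) :=
  let D := Y - B0 *m S in
  let G := invmx (S^T *m W *m S) in
  B0 + D *m G *m S^T *m W + W *m S *m G *m D^T
     - W *m S *m G *m (S^T *m D) *m G *m S^T *m W.

End linear_algebra.

Section gaussian_conditioning.
Context {R : realType}.

(* [normal_prob] takes the standard deviation and is not a Dirac mass when this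
   is 0, whereas linear images of a degenerate Gaussian vector can be constant. *)
Definition gaussian_law (m v : R) (A : set R) : \bar R :=
  if v == 0 then dirac m A else normal_prob m (Num.sqrt v) A.

(* Z ~ N(m, V), for a possibly singular V: every linear functional of Z is
   normally distributed, with the mean and variance given by m and V. *)
Definition gaussian_vector d (T : measurableType d) (P : probability T R) n
    (Z : T -> 'rV[R]_n) (m : 'rV[R]_n) (V : 'M[R]_n) :=
  (forall k, measurable_fun setT (fun w => Z w 0 k)) /\
  (forall (c : 'cV[R]_n) (A : set R), measurable A ->
     P [set w | A ((Z w *m c) 0 0)] =
     gaussian_law ((m *m c) 0 0) ((c^T *m V *m c) 0 0) A).

(* U is a version of the conditional expectation of the random variable Z given
   the sigma-algebra G. *)
Definition cond_expectation d (T : measurableType d) (P : probability T R)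
    (G : set (set T)) (Z U : T -> R) :=
  [/\ P.-integrable setT (EFin \o Z), P.-integrable setT (EFin \o U),
      forall A : set R, measurable A -> G (U @^-1` A) &
      forall E, G E -> (\int[P]_(w in E) (U w)%:E = \int[P]_(w in E) (Z w)%:E)%E].

(* g is a regression function of Z on O, i.e. E[Z | O] = g(O). *)
Definition cond_mean_fun d (T : measurableType d) (P : probability T R) n k
    (Z : T -> 'rV[R]_n) (O : T -> 'rV[R]_k) (g : 'rV[R]_k -> 'rV[R]_n) :=
  forall i, cond_expectation P (g_sigma_preimage (fun j w => O w 0 j))
    (fun w => Z w 0 i) (fun w => g (O w) 0 i).

(* E[Z | O = o] = m. As the event [O = o] may be null, this refers to a
   continuous regression function; all of these agree on the support of the law
   of O, hence m is determined by o whenever o is in that support. *)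
Definition cond_mean d (T : measurableType d) (P : probability T R) n k
    (Z : T -> 'rV[R]_n) (O : T -> 'rV[R]_k) (o : 'rV[R]_k) (m : 'rV[R]_n) :=
  exists g : 'rV[R]_k -> 'rV[R]_n,
    [/\ cond_mean_fun P Z O g, continuous g & g o = m].

(* For positive definite W and symmetric B0, the support of the law of X S is
   the set of all B S with B symmetric. *)
Definition gaussian_posterior_mean n M (W B0 : 'M[R]_n) (S Y : 'M[R]_(n, M))
    (Bpost : 'M[R]_n) :=
  forall d (T : measurableType d) (P : probability T R) (X : T -> 'M[R]_n),
    (forall w, (X w)^T = X w) ->
    gaussian_vector P (fun w => mxvec (X w)) (mxvec B0) (symkron W) ->
    cond_mean P (fun w => mxvec (X w)) (fun w => mxvec (X w *m S))
      (mxvec Y) (mxvec Bpost).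

End gaussian_conditioning.

(* Main.v *)
(* With D_k = B - B_k, a rank-2 update with column s is the congruence
   D_k = Q D_(k-1) Q^T, where Q = I - W s s^T / (s^T W s). When the Gram matrix
   is diagonal, the composition of these Q is I - P, where
   P = W S (S^T W S)^-1 S^T, and the posterior mean formula is also the
   congruence by I - P.

   For the probabilistic part, the residual (I - P)(X - B0)(I - P)^T is
   uncorrelated with X S. Let U be one of its coordinates and v an affine
   function of X S. Then a U + v and - a U + v have the same normal law, so
   2 E[cos v sin (a U)] = E[sin (a U + v)] - E[sin (- a U + v)] = 0; dividing by
   a and letting a tend to 0 gives E[U cos v] = 0. The bounded g such that
   E[U f cos v] = 0 for all v implies E[U f g cos v] = 0 for all v form an
   algebra that contains every cos v and is closed under bounded pointwise
   limits. It contains the sign of sin ((O_j - x) / k) as a limit of polynomials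
   in the sine, hence the sign of O_j - x, hence the indicators of the
   sigma-algebra generated by X S. So E[U | X S] = 0. *)
Require Import Defs.
From HB Require Import structures.
From mathcomp Require Import all_boot all_order all_algebra.
From mathcomp Require Import all_classical all_reals all_analysis.
From mathcomp Require Import measurable_realfun ring lra.

Set Implicit Arguments.
Unset Strict Implicit.
Unset Printing Implicit Defensive.

Import Order.TTheory GRing.Theory Num.Theory.
Import numFieldNormedType.Exports.

Local Open Scope classical_set_scope.
Local Open Scope ring_scope.

(** * Rank-2 updates as congruences *)

Section LinearAlgebra.
Context {R : realType}.

Lemma mxvec_trace m n (A B : 'M[R]_(m, n)) :
  (mxvec A *m (mxvec B)^T) 0 0 = \tr (A *m B^T).
Proof.
rewrite mxE (reindex _ (curry_mxvec_bij m n)) /=.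
transitivity (\sum_i \sum_j A i j * B i j).
  by rewrite pair_bigA; apply: eq_bigr => -[i j] _; rewrite [_^T _ _]mxE !mxvecE.
rewrite /mxtrace; apply: eq_bigr => i _; rewrite mxE.
by apply: eq_bigr => j _; rewrite mxE.
Qed.

(** The two products in [symkronE] contribute [F] and [F^T]. With [mxvec_trace], this turns
    covariances of linear functionals into traces. *)
Lemma mul_symkron n (W F : 'M[R]_n) :
  symkron W *m (mxvec F)^T =
  (mxvec (2^-1 *: (W *m (F + F^T) *m W^T)))^T.
Proof.
apply/colP => p; rewrite [RHS]mxE.
case/mxvec_indexP: p => i j; rewrite mxvecE mxE (reindex _ (curry_mxvec_bij n n)) /=.
transitivity (\sum_k \sum_l 2^-1 * (W i k * W j l + W j k * W i l) * F k l).
  rewrite pair_bigA; apply: eq_bigr => -[k l] _.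
  by rewrite symkronE mxE mxvecE.
have WFW (K : 'M[R]_n) : (W *m K *m W^T) i j = \sum_k \sum_l W i k * W j l * K k l.
  rewrite mxE exchange_big; apply: eq_bigr => l _; rewrite mxE big_distrl.
  by apply: eq_bigr => k _; rewrite mxE mulrAC.
rewrite mxE mulmxDr mulmxDl mxE !WFW.
rewrite [X in _ + X]exchange_big -big_split big_distrr; apply: eq_bigr => k _.
rewrite -big_split big_distrr; apply: eq_bigr => l _ /=.
by rewrite mxE -mulrA -mulrDl (mulrC (W j k)).
Qed.


(** For an invertible Gram matrix, the projection onto the range of [W *m S] along the kernel of
    [S^T]. *)
Definition oblique_projector n M (W : 'M[R]_n) (S : 'M[R]_(n, M)) : 'M[R]_n :=
  W *m S *m invmx (S^T *m W *m S) *m S^T.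

(** The correction to the prior mean, isolated because it is linear in [D]. *)
Definition posterior_gain n M (W : 'M[R]_n) (S D : 'M[R]_(n, M)) : 'M[R]_n :=
  let G := invmx (S^T *m W *m S) in
  D *m G *m S^T *m W + W *m S *m G *m D^T
     - W *m S *m G *m (S^T *m D) *m G *m S^T *m W.

Lemma posterior_meanE n M (W B0 : 'M[R]_n) (S Y : 'M[R]_(n, M)) :
  posterior_mean_formula W B0 S Y = B0 + posterior_gain W S (Y - B0 *m S).
Proof. by rewrite /posterior_mean_formula /posterior_gain !addrA. Qed.

Section Projector.
Variables (n M : nat) (W : 'M[R]_n) (S : 'M[R]_(n, M)).
Hypothesis W_sym : W^T = W.
Let P := oblique_projector W S.

Lemma tr_oblique_projector : P^T = S *m invmx (S^T *m W *m S) *m S^T *m W.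
Proof.
by rewrite !trmx_mul trmxK trmx_inv !trmx_mul trmxK W_sym !mulmxA.
Qed.

(** The congruence expands to D - P D - D P^T + P D P^T. As [D] is symmetric, the last three
    products depend on [D] only through [D *m S] and are the terms of the gain. *)
Lemma posterior_gain_congruence (D : 'M[R]_n) : D^T = D ->
  D - posterior_gain W S (D *m S) = (1%:M - P) *m D *m (1%:M - P)^T.
Proof.
move=> D_sym; rewrite [in RHS]linearB /= tr_scalar_mx.
rewrite mulmxBl mul1mx mulmxBr mulmx1 mulmxBl.
rewrite tr_oblique_projector /posterior_gain /P /oblique_projector.
rewrite trmx_mul D_sym !mulmxA.
by rewrite [X in _ - (X - _)]addrC -addrA opprD addrA opprB.
Qed.

(** [P] fixes [W *m S]. This later makes the residual uncorrelated with the observation. *)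
Lemma oblique_projectorWS : S^T *m W *m S \in unitmx ->
  (1%:M - P) *m W *m S = 0.
Proof.
move=> G_unit; rewrite mulmxBl mul1mx mulmxBl /P /oblique_projector.
by rewrite -!mulmxA [S^T *m _]mulmxA mulVmx // mulmx1 subrr.
Qed.

End Projector.

(** The same expansion for a single column, with the scalar s^T W s as Gram matrix. *)
Lemma rank2_update_congruence n (W B B0 : 'M[R]_n) (s : 'cV[R]_n) :
  W^T = W -> B^T = B -> B0^T = B0 ->
  let Q := 1%:M - ((s^T *m W *m s) 0 0)^-1 *: (W *m s *m s^T) in
  B - rank2_update W s (B *m s) B0 = Q *m (B - B0) *m Q^T.
Proof.
move=> W_sym B_sym B0_sym Q; rewrite /rank2_update trmx_mul W_sym -mulmxBl.
set D := B - B0; set g := (_ *m s) 0 0 in Q *.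
have D_sym : D^T = D by rewrite /D linearB /= B_sym B0_sym.
have -> : Q^T = 1%:M - g^-1 *: (s *m s^T *m W).
  by rewrite /Q linearB /= tr_scalar_mx linearZ /= !trmx_mul trmxK W_sym mulmxA.
rewrite -addrA [in LHS]opprD [in LHS]addrA -/D !trmx_mul D_sym /Q; clearbody D.
rewrite mulmxBl mul1mx mulmxBr mulmx1 mulmxBl.
rewrite -!scalemxAr -!scalemxAl scalerA -expr2 exprVn !mulmxA scalerDr.
by rewrite [X in _ - (X - _)]addrC -addrA opprD addrA opprB.
Qed.

(** Induction on the columns still to be processed, for every symmetric [B0]. Since distinct columns
    are W-orthogonal, the product of the factors collapses to 1 minus a sum. *)
Lemma rank2_updates_congruence n M (W B B0 : 'M[R]_n) (S : 'M[R]_(n, M)) (r : seq 'I_M) :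
  W^T = W -> B^T = B -> B0^T = B0 -> is_diag_mx (S^T *m W *m S) ->
  uniq r ->
  let g i := (S^T *m W *m S) i i in
  let Q := 1%:M - \sum_(i <- r) (g i)^-1 *: (W *m col i S *m (col i S)^T) in
  B - foldl (fun C i => rank2_update W (col i S) (col i (B *m S)) C) B0 r =
    Q *m (B - B0) *m Q^T.
Proof.
move=> W_sym B_sym B0_sym /is_diag_mxP G_diag.
have Gcol i j : (col i S)^T *m W *m col j S = ((S^T *m W *m S) i j)%:M.
  rewrite [LHS]mx11_scalar; congr (_%:M); rewrite !mxE; apply: eq_bigr => k _.
  by rewrite !mxE; congr (_ * _); apply: eq_bigr => l _; rewrite !mxE.
elim: r B0 B0_sym => [|i r IHr] B0 B0_sym /=.
  by move=> _; rewrite big_nil subr0 trmx1 mul1mx mulmx1.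
case/andP=> i_r r_uniq.
have colB : col i (B *m S) = B *m col i S by rewrite !colE mulmxA.
have := rank2_update_congruence (col i S) W_sym B_sym B0_sym.
rewrite /= -colB Gcol [(_%:M) _ _]mxE eqxx mulr1n.
set B1 := rank2_update _ _ _ _; set Qi := 1%:M - _; move=> B_B1.
(* The error [B - B1] is a congruence of a symmetric matrix. *)
have B1_sym : B1^T = B1.
  rewrite -[B1](subKr B) B_B1 linearB /= [in LHS]B_sym !trmx_mul trmxK.
  by rewrite [(B - B0)^T]linearB /= B_sym B0_sym !mulmxA.
rewrite IHr// B_B1 big_cons.
set q := \sum_(j <- r) _; set p := _ *: _.
(* The cross term [q *m p] contains the Gram entries (j, i) with [j] in [r]; they vanish because [i]
   is not in [r]. *)
have -> : 1%:M - (p + q) = (1%:M - q) *m Qi; last by rewrite !trmx_mul !mulmxA.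
rewrite /Qi -/p mulmxBl mul1mx mulmxBr mulmx1 [q *m p](_ : _ = 0) ?subr0 ?opprD ?addrA//.
rewrite mulmx_suml big_seq big1// => j j_r.
rewrite -scalemxAl -scalemxAr -!mulmxA [(col j S)^T *m _]mulmxA [_ *m (W *m _)]mulmxA.
rewrite [(_ *m W) *m (_ *m _)]mulmxA Gcol (G_diag j i); last first.
  by apply: contraNneq i_r => /ord_inj <-.
by rewrite raddf0 mul0mx !mulmx0 !scaler0.
Qed.

(** If v G = 0, then x = S v^T satisfies x^T W x = 0, so x = 0 by positivity and v = 0 by full
    column rank. *)
Lemma gram_unitmx n M (W : 'M[R]_n) (S : 'M[R]_(n, M)) :
  posdefmx W -> \rank S = M -> S^T *m W *m S \in unitmx.
Proof.
move=> W_pd rkS; rewrite -row_free_unit; apply: inj_row_free => v vG0.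
have ST_free : row_free S^T by rewrite /row_free mxrank_tr rkS.
have [Sv0|Sv0] := eqVneq (S *m v^T) 0.
  apply: (row_free_inj ST_free); rewrite mul0mx.
  by apply: trmx_inj; rewrite trmx_mul trmxK Sv0 trmx0.
have := W_pd _ Sv0.
rewrite (_ : _ *m _ *m _ = v *m (S^T *m W *m S) *m v^T).
  by rewrite vG0 mul0mx mxE ltxx.
by rewrite trmx_mul trmxK !mulmxA.
Qed.

Lemma oblique_projector_diag n M (W : 'M[R]_n) (S : 'M[R]_(n, M)) :
  S^T *m W *m S \in unitmx -> is_diag_mx (S^T *m W *m S) ->
  oblique_projector W S = \sum_i
    ((S^T *m W *m S) i i)^-1 *: (W *m col i S *m (col i S)^T).
Proof.
rewrite /oblique_projector; move: (_ *m _ *m S) => G G_unit /is_diag_mxP G_diag.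
(* Entry (i, j) of G G^-1 = 1, where diagonality leaves one term. It yields both [G i i != 0] and
   the entries of the inverse. *)
have GV i j : G i i * invmx G i j = (i == j)%:R.
  transitivity ((G *m invmx G) i j); last by rewrite mulmxV// mxE.
  rewrite mxE (bigD1 i)//= big1 ?addr0// => k; rewrite eq_sym => /G_diag ->.
  by rewrite mul0r.
have G_neq0 i : G i i != 0.
  by apply: contra_eq_neq (GV i i) => ->; rewrite mul0r eqxx eq_sym oner_neq0.
have {}GV : invmx G = diag_mx (\row_i (G i i)^-1).
  apply/matrixP => i j; apply: (mulfI (G_neq0 i)); rewrite GV !mxE.
  by rewrite mulrnAr divff.
under eq_bigr => i _ do rewrite -mulmxA scalemxAr.
rewrite -mulmx_sumr -!mulmxA; congr (_ *m _); rewrite mulmxA GV.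
apply/matrixP => a b; rewrite summxE mxE; apply: eq_bigr => i _.
by rewrite mul_mx_diag !mxE big_ord1 !mxE mulrCA mulrA.
Qed.

Lemma rank2_updatesE n M (W B B0 : 'M[R]_n) (S : 'M[R]_(n, M)) :
  W^T = W -> posdefmx W -> B^T = B -> B0^T = B0 -> \rank S = M ->
  is_diag_mx (S^T *m W *m S) ->
  rank2_updates W S (B *m S) B0 = posterior_mean_formula W B0 S (B *m S).
Proof.
move=> W_sym W_pd B_sym B0_sym rkS G_diag.
have G_unit := gram_unitmx W_pd rkS.
(* Compare the errors: on both sides they are the congruence of [B - B0] by 1 - P. *)
apply: (subrI B). rewrite /rank2_updates.
rewrite rank2_updates_congruence ?enum_uniq//= big_enum /=.
rewrite -oblique_projector_diag// -posterior_gain_congruence//; last first.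
  by rewrite linearB /= B_sym B0_sym.
by rewrite posterior_meanE mulmxBl [in RHS]opprD addrA.
Qed.
End LinearAlgebra.

(** * The normal distribution *)

Section Normal.
Context {R : realType}.

(* |x| is at most a constant times exp((x - m)^2 / (4 s^2)), and this factor
   turns the density of N(m, s^2) into a multiple of that of N(m, 2 s^2). *)
Lemma norm_normal_pdf_le (m s : R) : s != 0 -> exists K : R, forall x,
  `|x| * normal_pdf m s x <= K * normal_pdf m (Num.sqrt 2 * s) x.
Proof.
move=> s0.
have t0 : Num.sqrt 2 * s != 0 :> R by rewrite mulf_neq0// gt_eqF// sqrtr_gt0.
pose c := normal_peak s / normal_peak (Num.sqrt 2 * s).
have c_gt0 : 0 < c by rewrite divr_gt0// normal_peak_gt0.
(* [c] is the ratio of the peaks. The other factor comes from |x| <= |m| + 1 + 4 s^2 w, where w = (x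
   - m)^2 / (4 s^2). *)
exists ((`|m| + 1 + 4 * s ^+ 2) * c) => x.
rewrite !normal_pdfE//.
rewrite [X in X <= _]mulrCA [X in _ <= X](_ : _ = normal_peak s *
    ((`|m| + 1 + 4 * s ^+ 2) * normal_fun m (Num.sqrt 2 * s) x)); last first.
  by rewrite /c; field; rewrite gt_eqF ?normal_peak_gt0.
rewrite ler_wpM2l ?normal_peak_ge0// /normal_fun.
set u := (x - m) ^+ 2.
have s2 : 0 < s ^+ 2 by rewrite exprn_even_gt0.
have -> : - u / (s ^+ 2 *+ 2) = - (u / (4 * s ^+ 2)) - u / ((Num.sqrt 2 * s) ^+ 2 *+ 2).
  by rewrite exprMn sqr_sqrtr//; field.
rewrite expRD mulNr mulrA ler_wpM2r ?expR_ge0// expRN.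
rewrite ler_pdivrMr ?expR_gt0//.
have m0 := normr_ge0 m.
have k0 : 0 <= `|m| + 1 + 4 * s ^+ 2 by lra.
(* By exp w >= 1 + w, a bound of |x| that is linear in w suffices. *)
apply: le_trans (ler_wpM2l k0 (expR_ge1Dx _)).
have u0 : 0 <= u by exact: sqr_ge0.
have ux : `|x - m| <= 1 + u.
  have -> : u = `|x - m| ^+ 2 by rewrite real_normK ?num_real.
  set v := `|x - m|; have := sqr_ge0 (v - 1); have := sqr_ge0 v; nra.
have xm : `|x| <= `|m| + `|x - m| by rewrite -{1}[x](subrK m) addrC ler_normD.
have w0 : 0 <= u / (4 * s ^+ 2) by rewrite divr_ge0//; lra.
have uw : u = u / (4 * s ^+ 2) * (4 * s ^+ 2) by rewrite divfK// gt_eqF//; lra.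
set w := u / (4 * s ^+ 2) in w0 uw *.
rewrite uw in ux; have := mulr_ge0 m0 w0; have := mulr_ge0 (ltW s2) w0; nra.
Qed.


(** The Radon-Nikodym derivative and [normal_pdf] have the same integral over every measurable set,
    so they agree almost everywhere. *)
Lemma ge0_integral_normal_prob (m s : R) (f : R -> \bar R) :
  (forall x, 0 <= f x)%E -> measurable_fun setT f ->
  (\int[normal_prob m s]_x f x =
   \int[lebesgue_measure]_x (f x * (normal_pdf m s x)%:E))%E.
Proof.
move=> f0 mf; have dom := normal_prob_dominates m s.
rewrite -(Radon_Nikodym_SigmaFinite.change_of_variables dom)//.
have iRN := Radon_Nikodym_SigmaFinite.f_integrable dom.
have mpdf : measurable_fun setT (EFin \o normal_pdf m s).
  apply/measurable_EFinP; exact: measurable_normal_pdf.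
apply: ae_eq_integral => //.
- by apply: emeasurable_funM => //; exact: measurable_int iRN.
- exact: emeasurable_funM.
- apply: ae_eqe_mul2l; apply: integral_ae_eq => // A _ mA.
  by rewrite -Radon_Nikodym_SigmaFinite.f_integral.
Qed.

Lemma integrable_normal_prob (m s : R) : s != 0 ->
  (normal_prob m s).-integrable setT EFin.
Proof.
move=> s0; apply/integrableP; split; first exact/measurable_EFinP.
have [K hK] := norm_normal_pdf_le m s0.
rewrite ge0_integral_normal_prob//; last exact/measurableT_comp.
apply: (@le_lt_trans _ _
  (\int[lebesgue_measure]_x (K * normal_pdf m (Num.sqrt 2 * s) x)%:E)%E).
  apply: ge0_le_integral => //.
  - by move=> x _; rewrite mule_ge0// lee_fin normal_pdf_ge0.
  - apply: emeasurable_funM; first exact/measurableT_comp.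
    apply/measurable_EFinP; exact: measurable_normal_pdf.
  - apply/measurable_EFinP/measurable_funM => //; exact: measurable_normal_pdf.
  - by move=> x _; rewrite -EFinM lee_fin.
under eq_integral do rewrite EFinM.
by rewrite integralZl// ?integral_normal_pdf ?mule1 ?ltry//; exact: integrable_normal_pdf.
Qed.
End Normal.

(** * Sines and signs *)

Section RealLimits.
Context {R : realType}.
Implicit Types x : R.

Lemma measurable_sin : measurable_fun [set: R] sin.
Proof. exact: (continuous_measurable_fun (@continuous_sin R)). Qed.

Lemma measurable_cos : measurable_fun [set: R] cos.
Proof. exact: (continuous_measurable_fun (@continuous_cos R)). Qed.

Lemma sin_abs_le x : `|sin x| <= `|x|.
Proof.
wlog x_ge0 : x / 0 <= x => [hw|].
  have [/hw//|/ltW x_le0] := leP 0 x.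
  by rewrite -normrN -sinN -[leRHS]normrN hw// oppr_ge0.
have sin_cont : {within `[0, x], continuous (@sin R)}.
  by apply: continuous_subspaceT; exact: continuous_sin.
have sin_der y : y \in `]0, x[ -> is_derive y 1 (@sin R) (cos y).
  by move=> _; exact: is_derive_sin.
have [y _] := MVT_segment x_ge0 sin_der sin_cont.
rewrite sin0 !subr0 => ->.
by rewrite normrM ler_piMl ?cos_max.
Qed.

(** For nonzero x this is x times the difference quotient of sin at 0, along h = x / (k + 1). *)
Lemma sin_scaled_cvg x :
  (fun k : nat => k.+1%:R * sin (x / k.+1%:R)) @ \oo --> x.
Proof.
have [->|x_neq0] := eqVneq x 0.
  by under eq_cvg do rewrite mul0r sin0 mulr0; exact: cvg_cst.
have sin_quotient : (fun h : R => h^-1 * sin h) @ 0^' --> (1 : R).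
  have : (fun h : R => h^-1 *: ((sin \o shift 0) (h *: 1) - sin 0)) @ 0^' -->
      'D_1 sin (0 : R) by exact: (@derivable_sin R 0).
  rewrite derive_val cos0; apply: cvg_trans; apply: near_eq_cvg.
  by near=> h; rewrite /= sin0 subr0 addr0 /GRing.scale /= mulr1.
have scaled0 : (fun k : nat => x / k.+1%:R) @ \oo --> 0^'.
  move=> A A0'; have xk0 : (fun k : nat => x / k.+1%:R) @ \oo --> (0 : R).
    rewrite -[X in _ --> X](mulr0 x); apply: cvgMr; exact: cvg_harmonic.
  have : \forall k \near \oo, x / k.+1%:R != 0 -> A (x / k.+1%:R) := xk0 _ A0'.
  by apply: filterS => k; apply; rewrite mulf_neq0 ?invr_neq0 ?pnatr_eq0.
rewrite -[X in _ --> X]mulr1.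
have -> : (fun k : nat => k.+1%:R * sin (x / k.+1%:R)) =
    (fun k => x * ((x / k.+1%:R)^-1 * sin (x / k.+1%:R))).
  by apply/funext => k; rewrite invf_div; field.
apply: cvgMr; exact: (cvg_comp _ _ scaled0 sin_quotient).
Unshelve. all: by end_near. Qed.

(** The Newton-Schulz iteration for the sign, with fixed points -1, 0 and 1. As it is a polynomial,
    its iterates stay in any algebra of functions. *)
Definition sgn_step x : R := (3 * x - x ^+ 3) / 2.

Lemma sgn_step_norm_le x : `|x| <= 1 -> `|sgn_step x| <= 1.
Proof.
rewrite !ler_norml => /andP[x1 x2].
(* The two products are 2 (1 + [sgn_step x]) and 2 (1 - [sgn_step x]). *)
have lo : 0 <= (1 + x) ^+ 2 * (2 - x) by rewrite mulr_ge0 ?sqr_ge0//; lra.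
have up : 0 <= (1 - x) ^+ 2 * (2 + x) by rewrite mulr_ge0 ?sqr_ge0//; lra.
by rewrite /sgn_step; apply/andP; split; nra.
Qed.

Lemma iter_sgn_step_norm_le k x : `|x| <= 1 -> `|iter k sgn_step x| <= 1.
Proof. by move=> x1; elim: k => //= k; exact: sgn_step_norm_le. Qed.

Lemma iter_sgn_stepN k x : iter k sgn_step (- x) = - iter k sgn_step x.
Proof. by elim: k => //= k ->; rewrite /sgn_step; field. Qed.

Lemma iter_sgn_step0 k : iter k sgn_step 0 = 0.
Proof. by elim: k => //= k ->; rewrite /sgn_step expr0n /=; field. Qed.

(** Oddness reduces this to x > 0, where the distance to 1 decays geometrically. *)
Lemma iter_sgn_step_cvg x : `|x| <= 1 ->
  (fun k => iter k sgn_step x) @ \oo --> Num.sg x.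
Proof.
wlog x_ge0 : x / 0 <= x => [hw|] x1.
  have [/hw/(_ x1)//|/ltW x_le0] := leP 0 x.
  rewrite -[x]opprK sgrN; under eq_cvg do rewrite iter_sgn_stepN.
  by apply: cvgN; apply: hw; rewrite ?oppr_ge0 ?normrN.
have [->|x_neq0] := eqVneq x 0.
  by under eq_cvg do rewrite iter_sgn_step0; rewrite sgr0; exact: cvg_cst.
have x_gt0 : 0 < x by rewrite lt_neqAle eq_sym x_neq0.
have {}x1 : x <= 1 by rewrite -[x]ger0_norm.
rewrite gtr0_sg//.
(* [1 - sgn_step y = (1 - y) * ((1 - y) * (2 + y) / 2)], where the last factor
   is at most [1 - x / 2] for [x <= y <= 1]. *)
have bound k : x <= iter k sgn_step x <= 1 /\
    1 - iter k sgn_step x <= (1 - x / 2) ^+ k.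
  elim: k => [|k [/andP[xk k1] kb]] /=; first by rewrite lexx expr0; split; lra.
  set y := iter k _ _ in xk k1 kb *.
  have xy : x <= sgn_step y by rewrite /sgn_step; nra.
  have y1 : sgn_step y <= 1 by have := @sgn_step_norm_le y; rewrite !ler_norml; lra.
  split; first by rewrite xy y1.
  rewrite exprS; apply: le_trans (ler_wpM2l _ kb); last by lra.
  have -> : 1 - sgn_step y = (1 - y) * ((1 - y) * (2 + y) / 2).
    by rewrite /sgn_step; field.
  rewrite mulrC ler_wpM2r; nra.
have geo : (fun k => 1 - (1 - x / 2) ^+ k) @ \oo --> (1 : R).
  rewrite -[X in _ --> X]subr0; apply: cvgB; first exact: cvg_cst.
  by apply: cvg_expr; rewrite ger0_norm; lra.
apply: (squeeze_cvgr (h := fun=> 1) _ geo); last exact: cvg_cst.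
apply: nearW => k; have [/andP[_ ->] kb] := bound k.
by rewrite lerBlDr -lerBlDl kb.
Qed.

(** For x > 0 the sequence is eventually constant: x / (k + 1) ends up between 0 and pi. *)
Lemma sg_sin_scaled_cvg x :
  (fun k : nat => Num.sg (sin (x / k.+1%:R))) @ \oo --> Num.sg x.
Proof.
wlog x_ge0 : x / 0 <= x => [hw|].
  have [/hw//|/ltW x_le0] := leP 0 x.
  rewrite -[x]opprK sgrN; under eq_cvg do rewrite mulNr sinN sgrN.
  by apply: cvgN; apply: hw; rewrite ?oppr_ge0.
have [->|x_neq0] := eqVneq x 0.
  by under eq_cvg do rewrite mul0r sin0; exact: cvg_cst.
have x_gt0 : 0 < x by rewrite lt_neqAle eq_sym x_neq0.
apply: cvg_near_cst; near=> k; rewrite !gtr0_sg//.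
apply: sin_gt0_pi; rewrite divr_gt0//= ltr_pdivrMr// mulrC -ltr_pdivrMr ?pi_gt0//.
by rewrite -natr1 ltr_wpDr//; near: k; exact: nbhs_infty_gtr.
Unshelve. all: by end_near. Qed.

End RealLimits.

(** * Orthogonality to trigonometric functions *)

Section Orthogonality.
Context {R : realType} d (T : measurableType d) (P : probability T R).
Implicit Types f g : T -> R.

Definition bounded_mfun f :=
  measurable_fun setT f /\ exists C, forall w, `|f w| <= C.

Lemma bounded_mfun_cst r : bounded_mfun (fun=> r).
Proof. by split; [exact: measurable_cst|exists `|r|]. Qed.

Lemma bounded_mfunD f g :
  bounded_mfun f -> bounded_mfun g -> bounded_mfun (fun w => f w + g w).
Proof.
move=> [mf [C fC]] [mg [C' gC']]; split; first exact: measurable_funD.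
by exists (C + C') => w; rewrite (le_trans (ler_normD _ _))// lerD.
Qed.

Lemma bounded_mfunM f g :
  bounded_mfun f -> bounded_mfun g -> bounded_mfun (fun w => f w * g w).
Proof.
move=> [mf [C fC]] [mg [C' gC']]; split; first exact: measurable_funM.
by exists (C * C') => w; rewrite normrM ler_pM.
Qed.

Lemma bounded_mfun_cos f : measurable_fun setT f -> bounded_mfun (fun w => cos (f w)).
Proof.
move=> mf; split; first exact: (measurableT_comp measurable_cos).
by exists 1 => w; exact: cos_max.
Qed.

Lemma bounded_mfun_sin f : measurable_fun setT f -> bounded_mfun (fun w => sin (f w)).
Proof.
move=> mf; split; first exact: (measurableT_comp measurable_sin).
by exists 1 => w; exact: sin_max.
Qed.

Lemma integrable_bounded_mfun f : bounded_mfun f -> P.-integrable setT (EFin \o f).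
Proof.
move=> [mf [C fC]]; apply: measurable_bounded_integrable => //.
  by rewrite ltey_eq fin_num_measure.
by exists C; split; [exact: num_real|move=> x Cx w _; exact: le_trans (ltW Cx)].
Qed.

Section Factor.
Variable U : T -> R.
Hypothesis U_int : P.-integrable setT (EFin \o U).

Lemma measurable_integrand : measurable_fun setT U.
Proof. by apply/measurable_EFinP; exact: measurable_int U_int. Qed.

Lemma integrable_mul_bounded f : bounded_mfun f ->
  P.-integrable setT (EFin \o (fun w => U w * f w)).
Proof.
move=> [mf [C fC]]; apply: (le_integrable _ _ _ (integrableZl measurableT C U_int)) => //.
  apply/measurable_EFinP; apply: measurable_funM => //; exact: measurable_integrand.
move=> w _ /=; rewrite lee_fin normrM mulrC normrM ler_wpM2r//.
exact: le_trans (ler_norm _).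
Qed.

Definition orthogonal_to f := (\int[P]_w (U w * f w)%:E = 0)%E.

Lemma orthogonal_toD f g : bounded_mfun f -> bounded_mfun g ->
  orthogonal_to f -> orthogonal_to g -> orthogonal_to (fun w => f w + g w).
Proof.
rewrite /orthogonal_to => bf bg f0 g0; under eq_integral do rewrite mulrDr EFinD.
rewrite integralD_EFin ?f0 ?g0 ?adde0//; exact: integrable_mul_bounded.
Qed.

Lemma orthogonal_toZ r f : bounded_mfun f ->
  orthogonal_to f -> orthogonal_to (fun w => r * f w).
Proof.
rewrite /orthogonal_to => bf f0; under eq_integral do rewrite mulrCA EFinM.
by rewrite integralZl ?f0 ?mule0//; exact: integrable_mul_bounded.
Qed.

(** Dominated convergence with the bound |C U|. *)
Lemma orthogonal_to_lim (f_ : nat -> T -> R) f C :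
  (forall n, measurable_fun setT (f_ n)) -> (forall n w, `|f_ n w| <= C) ->
  (forall w, f_ ^~ w @ \oo --> f w) -> (forall n, orthogonal_to (f_ n)) ->
  orthogonal_to f.
Proof.
move=> mf_ f_C f_f f_0.
have mU := measurable_integrand.
have mf : measurable_fun setT f by apply: (@measurable_fun_cvg _ _ _ _ f_).
have [] := @dominated_convergence _ _ _ P setT measurableT
  (fun n w => (U w * f_ n w)%:E) (fun w => (U w * f w)%:E)
  (fun w => `|C%:E * (U w)%:E|%E).
- by move=> n; apply/measurable_EFinP; exact: measurable_funM.
- by apply/measurable_EFinP; exact: measurable_funM.
- apply/aeW => w _; apply/fine_cvgP; split; first exact: nearW.
  by apply: cvgMr; exact: f_f.
- by apply: integrable_abse; exact: integrableZl.
- apply/aeW => w n _ /=; rewrite lee_fin normrM mulrC normrM ler_wpM2r//.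
  exact: le_trans (ler_norm _).
move=> _ _; have /funext -> : forall n, (\int[P]_w (U w * f_ n w)%:E = 0)%E := f_0.
by rewrite /orthogonal_to => /cvg_lim <-//; rewrite lim_cst.
Qed.

End Factor.

(* [sin(aU + v) - sin(-aU + v) = 2 cos v sin(aU)] has mean zero; divide by [a]
   and let [a] tend to [0]. *)
Lemma orthogonal_to_cos_of_symmetry (U v : T -> R) :
  P.-integrable setT (EFin \o U) -> measurable_fun setT v ->
  (forall (a : R) (A : set R), measurable A ->
     P [set w | A (a * U w + v w)] = P [set w | A (- a * U w + v w)]) ->
  orthogonal_to U (fun w => cos (v w)).
Proof.
move=> U_int mv U_sym; have mU := measurable_integrand U_int.
pose lin a w : R := a * U w + v w.
have mlin a : measurable_fun setT (lin a).
  by apply: measurable_funD => //; exact: measurable_funM.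
(* The mean depends only on the law of [lin a], which is what [U_sym] compares. *)
have integral_sin a : (\int[P]_w (sin (lin a w))%:E =
    \int[pushforward P (lin a)]_y (sin y)%:E)%E.
  rewrite integral_pushforward//.
  - by apply/measurable_EFinP; exact: measurable_sin.
  - exact/integrable_bounded_mfun/bounded_mfun_sin.
have cos_sin a : (\int[P]_w (cos (v w) * sin (a * U w))%:E = 0)%E.
  have e w : cos (v w) * sin (a * U w) =
      2^-1 * (sin (lin a w) - sin (lin (- a) w)).
    by rewrite /lin !sinD mulNr sinN cosN; field.
  under eq_integral do rewrite e EFinM.
  have bs b := bounded_mfun_sin (mlin b).
  rewrite integralZl//; last first.
    exact: (integrableB measurableT (integrable_bounded_mfun (bs _))
                                    (integrable_bounded_mfun (bs _))).
  under eq_integral do rewrite EFinB.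
  rewrite integralB_EFin//; [|exact: integrable_bounded_mfun..].
  have -> : (\int[P]_w (sin (lin a w))%:E = \int[P]_w (sin (lin (- a)%R w))%:E)%E.
    rewrite !integral_sin; apply: eq_measure_integral => A mA _.
    exact: U_sym.
  rewrite subee ?mule0//.
  by apply: integrable_fin_num => //; exact: integrable_bounded_mfun.
(* This is a = 1 / (k + 1), divided by a; |U| dominates it because |sin x| <= |x|. *)
pose h k w : R := k.+1%:R * sin (U w / k.+1%:R) * cos (v w).
have mh k : measurable_fun setT (h k).
  apply: measurable_funM; last exact: (measurableT_comp measurable_cos).
  apply: measurable_funM => //; apply: (measurableT_comp measurable_sin).
  exact: measurable_funM.
have [] := @dominated_convergence _ _ _ P setT measurableT
  (fun k w => (h k w)%:E) (fun w => (U w * cos (v w))%:E) (fun w => `|(U w)%:E|%E).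
- by move=> k; apply/measurable_EFinP.
- apply/measurable_EFinP; apply: measurable_funM => //.
  exact: (measurableT_comp measurable_cos).
- apply/aeW => w _; apply/fine_cvgP; split; first exact: nearW.
  by apply: cvgMl; exact: sin_scaled_cvg.
- exact: integrable_abse.
- apply/aeW => w k _; rewrite lee_fin normrM.
  apply: le_trans (ler_wpM2l _ (cos_max _)) _ => //; rewrite mulr1 normrM.
  rewrite gtr0_norm// mulrC -ler_pdivlMr//.
  by rewrite (le_trans (sin_abs_le _))// normf_div normr_nat.
have /funext h_0 : forall k, (\int[P]_w (h k w)%:E = 0)%E.
  move=> k; under eq_integral do
    rewrite /h -mulrA [sin _ * _]mulrC [U _ / _]mulrC EFinM.
  rewrite integralZl// ?cos_sin ?mule0//.
  apply/integrable_bounded_mfun/bounded_mfunM; first exact: bounded_mfun_cos.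
  by apply: bounded_mfun_sin; exact: measurable_funM.
move=> _ _; rewrite h_0.
by rewrite /orthogonal_to => /cvg_lim <-//; rewrite lim_cst.
Qed.

End Orthogonality.

(** * Multipliers that preserve orthogonality *)

Section Multipliers.
Context {R : realType} d (T : measurableType d) (P : probability T R).
Variables (U : T -> R) (L : set (T -> R)).
Hypothesis U_int : P.-integrable setT (EFin \o U).
Hypothesis L_measurable : forall v, L v -> measurable_fun setT v.
Hypothesis L_cst : forall r, L (fun=> r).
Hypothesis L_lin : forall a u v, L u -> L v -> L (fun w => a * u w + v w).
Hypothesis cos_orthogonal : forall v, L v -> orthogonal_to P U (fun w => cos (v w)).
Implicit Types f g v : T -> R.

(** Testing against every cosine, and not only against 1, makes the class stable under
    multiplication by cosines. *)
Definition strongly_orthogonal f := bounded_mfun f /\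
  forall v, L v -> orthogonal_to P U (fun w => f w * cos (v w)).

(** Multipliers compose, so closure under products is immediate. *)
Definition orthogonal_multiplier g := bounded_mfun g /\
  forall f, strongly_orthogonal f -> strongly_orthogonal (fun w => f w * g w).

Lemma orthogonal_multiplierP g : bounded_mfun g ->
  (forall f, strongly_orthogonal f -> forall v, L v ->
    orthogonal_to P U (fun w => f w * g w * cos (v w))) ->
  orthogonal_multiplier g.
Proof.
move=> bg fg; split => // f f_orth; split => [|v Lv]; last exact: fg.
by apply: bounded_mfunM => //; case: f_orth.
Qed.

Lemma bounded_mfun_cosL v : L v -> bounded_mfun (fun w => cos (v w)).
Proof. by move=> Lv; apply: bounded_mfun_cos; exact: L_measurable. Qed.

Lemma orthogonal_multiplier_cst r : orthogonal_multiplier (fun=> r).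
Proof.
apply: orthogonal_multiplierP => [|f [bf f_orth] v Lv].
  exact: bounded_mfun_cst.
under eq_fun do rewrite [f _ * r]mulrC -mulrA.
apply: orthogonal_toZ => //; last exact: f_orth.
exact: (bounded_mfunM bf (bounded_mfun_cosL Lv)).
Qed.

Lemma orthogonal_multiplierD g1 g2 :
  orthogonal_multiplier g1 -> orthogonal_multiplier g2 ->
  orthogonal_multiplier (fun w => g1 w + g2 w).
Proof.
move=> [bg1 m1] [bg2 m2].
apply: orthogonal_multiplierP => [|f f_orth v Lv]; first exact: bounded_mfunD.
under eq_fun do rewrite mulrDr mulrDl.
have [b1 o1] := m1 _ f_orth; have [b2 o2] := m2 _ f_orth.
have bcos := bounded_mfun_cosL Lv.
by apply: orthogonal_toD; [|exact: bounded_mfunM..|exact: o1|exact: o2].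
Qed.

Lemma orthogonal_multiplierM g1 g2 :
  orthogonal_multiplier g1 -> orthogonal_multiplier g2 ->
  orthogonal_multiplier (fun w => g1 w * g2 w).
Proof.
move=> [bg1 m1] [bg2 m2]; split => [|f f_orth]; first exact: bounded_mfunM.
by under eq_fun do rewrite mulrA; exact/m2/m1.
Qed.

Lemma orthogonal_multiplier_lim (g_ : nat -> T -> R) g C :
  (forall n, orthogonal_multiplier (g_ n)) -> (forall n w, `|g_ n w| <= C) ->
  (forall w, g_ ^~ w @ \oo --> g w) -> orthogonal_multiplier g.
Proof.
move=> m_ g_C g_g.
have bg : bounded_mfun g.
  split.
    apply: (@measurable_fun_cvg _ _ _ _ g_) => [n|w _]; last exact: g_g.
    by have [[]] := m_ n.
  by exists C => w; apply: (cvgr_to_le (cvg_norm (g_g w))); exact: nearW.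
apply: orthogonal_multiplierP => // f f_orth v Lv.
have [[mf [Cf fC]] _] := f_orth.
apply: (orthogonal_to_lim U_int (f_ := fun n w => f w * g_ n w * cos (v w))
  (C := Cf * C)) => [n|n w|w|n].
- have [[mg _] _] := m_ n; apply: measurable_funM; first exact: measurable_funM.
  by case: (bounded_mfun_cosL Lv).
- rewrite normrM; apply: le_trans (ler_wpM2l _ (cos_max _)) _ => //.
  by rewrite mulr1 normrM ler_pM.
- by apply: cvgMl; apply: cvgMr; exact: g_g.
- by have [_ /(_ _ f_orth) [_]] := m_ n; exact.
Qed.

(** By the product-to-sum formula, cos u cos v is the mean of two cosines whose arguments lie in
    [L]. *)
Lemma orthogonal_multiplier_cos u : L u -> orthogonal_multiplier (fun w => cos (u w)).
Proof.
move=> Lu; apply: orthogonal_multiplierP => [|f [bf f_orth] v Lv].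
  exact: bounded_mfun_cosL.
have Luv a : L (fun w => a * v w + u w) by exact: L_lin.
have -> : (fun w => f w * cos (u w) * cos (v w)) = (fun w =>
    2^-1 * (f w * cos (1 * v w + u w)) + 2^-1 * (f w * cos (- 1 * v w + u w))).
  by apply/funext => w; rewrite mul1r mulN1r !cosD cosN sinN; field.
have b a : bounded_mfun (fun w => f w * cos (a * v w + u w)).
  exact: (bounded_mfunM bf (bounded_mfun_cosL (Luv a))).
by apply: orthogonal_toD => //;
  [exact: (bounded_mfunM (bounded_mfun_cst _ _) (b _))..| |];
  apply: orthogonal_toZ => //; exact: (f_orth _ (Luv _)).
Qed.

Lemma orthogonal_multiplier_sin u : L u -> orthogonal_multiplier (fun w => sin (u w)).
Proof.
move=> Lu; have := orthogonal_multiplier_cos (L_lin 1 Lu (L_cst (- (pi / 2)))).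
by under eq_fun do rewrite mul1r cosBpihalf.
Qed.

(** Two successive limits: polynomials in sin (u / (k + 1)) tend to the sign of that sine, which
    tends to the sign of u. *)
Lemma orthogonal_multiplier_sg u : L u ->
  orthogonal_multiplier (fun w => Num.sg (u w)).
Proof.
move=> Lu; apply: (orthogonal_multiplier_lim (C := 1)
  (g_ := fun k w => Num.sg (sin (u w / k.+1%:R)))) => [k|k w|w].
- apply: (orthogonal_multiplier_lim (C := 1)
    (g_ := fun i w => iter i sgn_step (sin (u w / k.+1%:R)))) => [i|i w|w].
  + elim: i => [|i IHi] /=.
      have := orthogonal_multiplier_sin (L_lin k.+1%:R^-1 Lu (L_cst 0)).
      by under eq_fun do rewrite addr0 mulrC.
    set x := (fun w => iter i _ _) in IHi *.
    have -> : (fun w => sgn_step (x w)) =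
        (fun w => 3 / 2 * x w + - 2^-1 * (x w * (x w * x w))).
      by apply/funext => w; rewrite /sgn_step; field.
    have cst r := orthogonal_multiplier_cst r.
    apply: orthogonal_multiplierD; apply: orthogonal_multiplierM => //.
    by apply: orthogonal_multiplierM => //; exact: orthogonal_multiplierM.
  + exact/iter_sgn_step_norm_le/sin_max.
  + exact/iter_sgn_step_cvg/sin_max.
- by rewrite normr_sg lern1 leq_b1.
- exact: sg_sin_scaled_cvg.
Qed.

Lemma orthogonal_multiplier_indic_gt0 u : L u ->
  orthogonal_multiplier (\1_[set w | 0 < u w]).
Proof.
move=> Lu; have sg := orthogonal_multiplier_sg Lu.
(* For a sign s in {-1, 0, 1}, (s + s^2) / 2 is 1 if s = 1 and 0 otherwise. *)
have -> : (\1_[set w | 0 < u w] : T -> R) =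
    (fun w => 2^-1 * (Num.sg (u w) + Num.sg (u w) * Num.sg (u w))).
  apply/funext => w; rewrite indicE /=.
  have [u_lt0|u_gt0|u0] := ltgtP (u w) 0.
  - rewrite memNset /= ?ltr0_sg ?mulrNN ?mulr1 ?addNr ?mulr0//.
    by apply/negP; rewrite -leNgt ltW.
  - by rewrite mem_set// gtr0_sg// mulr1 mulVf.
  - by rewrite memNset /= u0 ?ltxx// sgr0 mul0r addr0 mulr0.
apply: orthogonal_multiplierM; first exact: orthogonal_multiplier_cst.
by apply: orthogonal_multiplierD => //; exact: orthogonal_multiplierM.
Qed.

Definition multiplier_set (E : set T) :=
  measurable E /\ orthogonal_multiplier (\1_E).

Lemma multiplier_setC E : multiplier_set E -> multiplier_set (~` E).
Proof.
move=> [mE oE]; split; first exact: measurableC.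
have -> : (\1_(~` E) : T -> R) = (fun w => 1 + -1 * \1_E w).
  by apply/funext => w; rewrite !indicE in_setC; case: (w \in E); rewrite /=; field.
have cst r := orthogonal_multiplier_cst r.
by apply: orthogonal_multiplierD => //; exact: orthogonal_multiplierM.
Qed.

(** By De Morgan, since the indicator of an intersection is a product. *)
Lemma multiplier_setU E1 E2 :
  multiplier_set E1 -> multiplier_set E2 -> multiplier_set (E1 `|` E2).
Proof.
move=> E1_mult E2_mult; rewrite -[E1 `|` E2]setCK; apply: multiplier_setC.
have [[m1 o1] [m2 o2]] := (multiplier_setC E1_mult, multiplier_setC E2_mult).
rewrite setCU; split; first exact: measurableI.
by rewrite indicI; exact: orthogonal_multiplierM.
Qed.

(** A countable union is handled as the pointwise limit of the indicators of its finite partial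
    unions. *)
Lemma sigma_algebra_multiplier_set : sigma_algebra setT multiplier_set.
Proof.
have mult0 : multiplier_set set0.
  by split => //; rewrite indic0; exact: orthogonal_multiplier_cst.
split => // [A /multiplier_setC|A A_mult]; first by rewrite setTD.
split; first by apply: bigcup_measurable => k _; case: (A_mult k).
apply: (orthogonal_multiplier_lim (C := 1)
    (g_ := fun n => \1_(\big[setU/set0]_(i < n) A i))) => [n|n w|w].
- suff : multiplier_set (\big[setU/set0]_(i < n) A i) by case.
  by apply: big_ind => //; exact: multiplier_setU.
- by rewrite indicE ger0_norm// lern1 leq_b1.
- have [[i _ Aiw]|Aw] := pselect ((\bigcup_k A k) w).
    have UAw : (\bigcup_k A k) w by exists i.
    apply: cvg_near_cst; near=> n; rewrite !indicE (mem_set UAw) mem_set//.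
    by rewrite -bigcup_mkord; exists i => //=; near: n; exact: nbhs_infty_gt.
  apply: cvg_near_cst; apply: nearW => n; rewrite !indicE (memNset Aw) memNset//.
  by rewrite -bigcup_mkord => -[i _ Aiw]; apply: Aw; exists i.
Unshelve. all: by end_near. Qed.

(** The sets with this property form a sigma-algebra, so the rays that generate the Borel sets
    suffice. *)
Lemma multiplier_set_preimage v (A : set R) :
  L v -> measurable A -> multiplier_set (v @^-1` A).
Proof.
move=> Lv mA; have [m0 mC mU] := sigma_algebra_multiplier_set.
suff : (@RGenOInfty.G R).-sigma.-measurable `<=` [set A | multiplier_set (v @^-1` A)].
  by apply; rewrite -RGenOInfty.measurableE.
apply: smallest_sub => [|_ [x ->] /=].
  split => /= [|B /mC|B B_mult].
  - by rewrite preimage_set0.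
  - by rewrite !setTD preimage_setC.
  - by rewrite preimage_bigcup; exact: mU.
split; first by rewrite -[X in measurable X]setTI; exact: L_measurable.
have -> : v @^-1` `]x, +oo[ = [set w | 0 < 1 * v w + - x].
  by apply/seteqP; split => w /=; rewrite in_itv/= andbT mul1r subr_gt0.
by apply: orthogonal_multiplier_indic_gt0; exact: L_lin.
Qed.

Lemma integral_sigma_preimage0 n (O : 'I_n -> T -> R) (E : set T) :
  (forall j, L (O j)) -> g_sigma_preimage O E ->
  measurable E /\ (\int[P]_(w in E) (U w)%:E = 0)%E.
Proof.
move=> LO OE; suff [mE oE] : multiplier_set E.
  split => //; rewrite integral_mkcond.
  (* Start from the constant 1, multiply by the indicator of [E], and test with v = 0, where cos v =
     1. *)
  have one_orth : strongly_orthogonal (fun=> 1).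
    split; first exact: bounded_mfun_cst.
    by move=> v Lv; under eq_fun do rewrite mul1r; exact: cos_orthogonal.
  have [_ /(_ _ one_orth) [_ /(_ _ (L_cst 0))]] := oE.
  rewrite /orthogonal_to => <-; apply: eq_integral => w _.
  by rewrite patchE cos0 mul1r mulr1 indicE; case: (w \in E); rewrite ?mulr1 ?mulr0.
apply: OE; split; first exact: sigma_algebra_multiplier_set.
move=> B; rewrite -bigcup_seq => -[j _ [A mA <-]].
by rewrite setTI; exact: multiplier_set_preimage.
Qed.

End Multipliers.

(** * Gaussian vectors *)

Section GaussianLaw.
Context {R : realType}.

Lemma lebesgue_measure_shift (t : R) (A : set R) : measurable A ->
  pushforward lebesgue_measure (shift t : _ -> measurableTypeR R) A =
  lebesgue_measure A.
Proof.
have mt : measurable_fun setT (shift t : measurableTypeR R -> measurableTypeR R).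
  exact: measurable_funD.
move=> mA; apply/esym/lebesgue_measure_unique => //= _ [[a b]] _ <-.
rewrite /pushforward (_ : _ @^-1` _ = `]a - t, b - t]%classic).
  rewrite !lebesgue_measure_itv/= !lte_fin ltrD2r -!EFinB.
  by rewrite opprB addrA subrK.
by apply/seteqP; split => x /=; rewrite !in_itv/= ltrBlDr lerBrDr.
Qed.

Lemma normal_prob_shift (m s t : R) (A : set R) : s != 0 -> measurable A ->
  normal_prob m s [set x | A (x + t)] = normal_prob (m + t) s A.
Proof.
move=> s0 mA; rewrite /normal_prob.
have mt : measurable_fun setT (shift t : measurableTypeR R -> measurableTypeR R).
  exact: measurable_funD.
transitivity (\int[pushforward lebesgue_measure
    (shift t : _ -> measurableTypeR R)]_(x in A) (normal_pdf (m + t) s x)%:E)%E.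
  rewrite ge0_integral_pushforward//.
  - apply: eq_integral => x _; rewrite /= !normal_pdfE// /normal_fun.
    by rewrite opprD addrACA subrr addr0.
  - apply/measurable_EFinP; apply: measurable_funTS; exact: measurable_normal_pdf.
  - by move=> x _; rewrite lee_fin normal_pdf_ge0.
by apply: eq_measure_integral => B mB _; exact: lebesgue_measure_shift.
Qed.

(** [Num.sqrt] is 0 on negative reals; [0 <= v] ensures a nonzero deviation outside the Dirac
    case. *)
Lemma gaussian_law_shift (m v t : R) (A : set R) : 0 <= v -> measurable A ->
  gaussian_law m v [set x | A (x + t)] = gaussian_law (m + t) v A.
Proof.
rewrite /gaussian_law => v_ge0 mA; case: eqVneq => [_|v0]; first by rewrite !diracE.
by apply: normal_prob_shift; rewrite // gt_eqF// sqrtr_gt0 lt_neqAle eq_sym v0.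
Qed.

(** For deviation 0, [normal_pdf] is by convention the indicator of [0, 1]. *)
Lemma normal_prob0_gt0 (m : R) : normal_prob m 0 `]0, +oo[%classic = 1%E.
Proof.
rewrite /normal_prob /normal_pdf eqxx integral_indic//.
rewrite (_ : _ `&` _ = `]0, 1]%classic).
  by rewrite /= lebesgue_measure_itv/= lte01 oppr0 adde0.
apply/seteqP; split => x /=; rewrite !in_itv/= ?andbT.
- by move=> [/andP[_ ->] ->].
- by move=> /andP[x0 x1]; rewrite x0 x1 ltW.
Qed.

End GaussianLaw.

Section GaussianVector.
Context {R : realType} d (T : measurableType d) (P : probability T R).
Variables (n : nat) (Z : T -> 'rV[R]_n) (m : 'rV[R]_n) (V : 'M[R]_n).
Hypothesis Z_gauss : gaussian_vector P Z m V.
Implicit Types c : 'cV[R]_n.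

Lemma gaussian_vector_measurable c : measurable_fun setT (fun w => (Z w *m c) 0 0).
Proof.
under eq_fun do rewrite mxE.
apply: measurable_sum => k; apply: measurable_funM => //.
by have [mZ _] := Z_gauss; exact: mZ.
Qed.

(* For a negative variance [gaussian_law] is the uniform law on [0, 1], which
   cannot be the law of both a random variable and its opposite. *)
Lemma gaussian_vector_variance_ge0 c : 0 <= (c^T *m V *m c) 0 0.
Proof.
rewrite leNgt; apply/negP => v_lt0.
have half (u : 'cV_n) : (u^T *m V *m u) 0 0 < 0 -> P [set w | 0 < (Z w *m u) 0 0] = 1%E.
  move=> v'_lt0; have [_ lawZ] := Z_gauss.
  have := lawZ u `]0, +oo[%classic (measurable_itv _).
  rewrite /gaussian_law lt_eqF// ler0_sqrtr ?ltW// normal_prob0_gt0 => <-.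
  by congr (P _); apply/seteqP; split => w /=; rewrite in_itv/= andbT.
pose c' := - c.
have oppE w : (Z w *m c') 0 0 = - (Z w *m c) 0 0 by rewrite mulmxN mxE.
have mpos (u : 'cV_n) : measurable [set w | 0 < (Z w *m u) 0 0].
  have := gaussian_vector_measurable u measurableT (measurable_itv `]0, +oo[).
  rewrite setTI; congr measurable; apply/seteqP.
  by split => w /=; rewrite in_itv/= andbT.
pose A := [set w | 0 < (Z w *m c) 0 0]; pose B := [set w | 0 < (Z w *m c') 0 0].
have PA : P A = 1%E by exact: half.
have PB : P B = 1%E.
  by apply: half; rewrite [c'^T]linearN /= mulmxN !mulNmx opprK.
have AB0 : A `&` B = set0.
  apply/seteqP; split => w //= -[Aw Bw].
  have : 0 < - (Z w *m c) 0 0 by rewrite -oppE; exact: Bw.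
  by rewrite oppr_gt0 => /(lt_trans Aw); rewrite ltxx.
have : (P A + P B <= 1)%E.
  rewrite -measureU//; [|exact: mpos..].
  by apply: probability_le1; apply: measurableU; exact: mpos.
by rewrite PA PB -EFinD lee_fin; lra.
Qed.

(** The absolute moment depends only on the law, which is a point mass or a nondegenerate normal
    law. *)
Lemma gaussian_vector_integrable c :
  P.-integrable setT (EFin \o (fun w => (Z w *m c) 0 0)).
Proof.
have mZc := gaussian_vector_measurable c; have [_ lawZ] := Z_gauss.
pose h w : measurableTypeR R := (Z w *m c) 0 0.
apply/integrableP; split; first exact/measurable_EFinP.
have mabs : measurable_fun [set: measurableTypeR R] (fun y : R => `|y%:E|%E).
  by apply: measurableT_comp => //; exact/measurable_EFinP.
have -> : (\int[P]_w `|(EFin \o h) w| = \int[pushforward P h]_y `|y%:E|)%E.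
  by rewrite ge0_integral_pushforward.
pose v := (c^T *m V *m c) 0 0.
have [v0|v0] := eqVneq v 0.
  rewrite (eq_measure_integral (dirac ((m *m c) 0 0 : measurableTypeR R))) => [|A mA _].
    by rewrite integral_dirac// diracT mul1e ltry.
  by rewrite [LHS]lawZ// /gaussian_law -/v v0 eqxx.
have s_neq0 : Num.sqrt v != 0.
  by rewrite gt_eqF// sqrtr_gt0 lt_neqAle eq_sym v0 gaussian_vector_variance_ge0.
have /integrableP[_] := integrable_normal_prob ((m *m c) 0 0) s_neq0.
congr (_ < _)%E; apply: eq_measure_integral => A mA _.
by rewrite [RHS]lawZ// /gaussian_law -/v (negbTE v0).
Qed.

(** With zero covariance, the variance of a U + v involves a only through a^2, so the law is the
    same for a and -a. *)
Lemma gaussian_vector_orthogonal (e f : 'cV[R]_n) (b : R) :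
  V^T = V -> e^T *m V *m f = 0 ->
  orthogonal_to P (fun w => ((Z w - m) *m e) 0 0)
    (fun w => cos ((Z w *m f) 0 0 + b)).
Proof.
move=> V_sym eVf.
have centerE w c : ((Z w - m) *m c) 0 0 = (Z w *m c) 0 0 - (m *m c) 0 0.
  by rewrite mulmxBl !mxE.
apply: orthogonal_to_cos_of_symmetry.
- under eq_fun do rewrite centerE.
  exact: (integrableB measurableT (gaussian_vector_integrable _)
    (finite_measure_integrable_cst _ _ measurableT)).
- by apply: measurable_funD => //; exact: gaussian_vector_measurable.
move=> a A mA.
have lawE (a' : R) : P [set w | A (a' * ((Z w - m) *m e) 0 0 + ((Z w *m f) 0 0 + b))] =
    gaussian_law ((m *m f) 0 0 + b)
      (a' ^+ 2 * (e^T *m V *m e) 0 0 + (f^T *m V *m f) 0 0) A.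
  pose c := a' *: e + f; have [_ lawZ] := Z_gauss.
  have -> : a' ^+ 2 * (e^T *m V *m e) 0 0 + (f^T *m V *m f) 0 0 = (c^T *m V *m c) 0 0.
    have fVe : f^T *m V *m e = 0.
      by apply: trmx_inj; rewrite !trmx_mul trmxK V_sym mulmxA eVf trmx0.
    rewrite /c [(_ + _)^T]linearD /= [(_ *: _)^T]linearZ /=.
    rewrite !mulmxDl !mulmxDr -!scalemxAl -!scalemxAr.
    by rewrite eVf fVe !scaler0 addr0 add0r scalerA -expr2 !mxE.
  have cE (z : 'rV[R]_n) : (z *m c) 0 0 = a' * (z *m e) 0 0 + (z *m f) 0 0.
    by rewrite mulmxDr -scalemxAr mxE [X in X + _]mxE.
  (* [t] collects the centering and the offset, so that the variable is [(Z w *m c) 0 0 + t]. *)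
  pose t := b - a' * (m *m e) 0 0.
  have -> : (m *m f) 0 0 + b = (m *m c) 0 0 + t by rewrite cE /t; ring.
  rewrite -gaussian_law_shift ?gaussian_vector_variance_ge0// -lawZ; last first.
    have mt : measurable_fun setT (fun x : R => x + t) by exact: measurable_funD.
    by rewrite -[X in measurable X]setTI; exact: mt.
  congr (P _); apply/funext => w /=; congr A.
  by rewrite centerE cE /t; ring.
by rewrite !lawE sqrrN.
Qed.

End GaussianVector.

(** * The posterior mean *)

Section Posterior.
Context {R : realType}.

Lemma tr_symkron n (W : 'M[R]_n) : W^T = W -> (symkron W)^T = symkron W.
Proof.
move=> W_sym; have Wji i j : W j i = W i j by rewrite -{1}W_sym mxE.
apply/matrixP => p q; case/mxvec_indexP: p => i j; case/mxvec_indexP: q => k l.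
by rewrite mxE !symkronE !(Wji i) !(Wji j) [W i l * _]mulrC.
Qed.

Lemma continuous_rV m n (f : 'rV[R]_m -> 'rV[R]_n) :
  (forall i, continuous (fun x => f x 0 i)) -> continuous f.
Proof.
move=> f_cont x.
apply/(@cvg_mx_entourageP _ _ _ _ (fmap_filter _ (nbhs_filter x))) => A entA.
have : forall j : 'I_n, \forall y \near x, A (f x 0 j, f y 0 j).
  by move=> j; have /cvg_app_entourageP /(_ A entA) := f_cont j x.
move=> /filter_forall; apply: filterS => y Ay i j.
by rewrite [i]ord1 inE; exact: Ay.
Qed.

Lemma continuous_affine k (a : 'I_k -> R) (b : R) :
  continuous (fun x : 'rV[R]_k => \sum_i x 0 i * a i + b).
Proof.
move=> x; apply: (@cvgD _ _ _ (nbhs x) (nbhs_filter x)); last exact: cvg_cst.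
apply: (@cvg_big _ _ _ _ _ _ _ (nbhs x)) => [|i _]; first exact: add_continuous.
by apply: (@cvgMl _ _ (nbhs x) (nbhs_filter x)); exact: coord_continuous.
Qed.

Lemma g_sigma_preimage_affine (T : pointedType) k (f : 'I_k -> T -> R)
    (a : 'I_k -> R) (b : R) (A : set R) : measurable A ->
  g_sigma_preimage f ((fun w => \sum_i f i w * a i + b) @^-1` A).
Proof.
move=> mA; rewrite /g_sigma_preimage; set gen := (X in <<s X >>).
(* Measurability here refers to [T] with the sigma-algebra generated by [gen]. *)
have mf i : measurable_fun setT (f i : g_sigma_algebraType gen -> R).
  move=> _ B mB; rewrite setTI; apply: sub_sigma_algebra.
  rewrite /gen -bigcup_seq; exists i; first by rewrite /= mem_index_enum.
  by exists B; rewrite ?setTI.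
have mg : measurable_fun setT
    (fun w : g_sigma_algebraType gen => \sum_i f i w * a i + b).
  by apply: measurable_funD => //; apply: measurable_sum => i; exact: measurable_funM.
by have := mg measurableT A mA; rewrite setTI.
Qed.

Variables (n M : nat) (W B0 : 'M[R]_n) (S : 'M[R]_(n, M)).

(** The gain on row vectors, so that [lin1_mx] provides its matrix. *)
Let gain_vec (u : 'rV[R]_(n * M)) := mxvec (posterior_gain W S (vec_mx u)).

Let gain_vec_linear : linear gain_vec.
Proof.
move=> a u v; rewrite /gain_vec -linearP; congr mxvec; rewrite linearP /=.
rewrite /posterior_gain linearP /= !mulmxDl !mulmxDr !mulmxDl.
rewrite -!scalemxAl -!scalemxAr -!scalemxAl scalerBr scalerDr opprD.
by rewrite !addrA; congr (_ - _); rewrite addrAC; congr (_ + _); rewrite -!addrA;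
  congr (_ + _); rewrite addrC addrA addrAC.
Qed.

HB.instance Definition _ := GRing.isLinear.Build _ _ _ _ gain_vec gain_vec_linear.

(** The posterior mean as an affine function of the observation; it will be the continuous version
    of E[X | X S]. *)
Definition regression (o : 'rV[R]_(n * M)) : 'rV[R]_(n * n) :=
  mxvec B0 + (o - mxvec (B0 *m S)) *m lin1_mx gain_vec.

Lemma regressionE (Y : 'M[R]_(n, M)) :
  regression (mxvec Y) = mxvec (posterior_mean_formula W B0 S Y).
Proof.
rewrite posterior_meanE linearD /= /regression; congr (_ + _).
by rewrite -linearB mul_rV_lin1 /= /gain_vec mxvecK.
Qed.

Lemma regression_coord o p : regression o 0 p =
  \sum_k o 0 k * lin1_mx gain_vec k p + regression 0 0 p.
Proof.
rewrite /regression sub0r mulmxBl mulNmx addrCA mxE; congr (_ + _).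
by rewrite mxE.
Qed.

Lemma continuous_regression : continuous regression.
Proof.
apply: continuous_rV => p; under eq_fun do rewrite regression_coord.
exact: continuous_affine.
Qed.

Hypothesis W_sym : W^T = W.
Hypothesis B0_sym : B0^T = B0.
Hypothesis G_unit : S^T *m W *m S \in unitmx.

Let Q := 1%:M - oblique_projector W S.

(** The covariance of a functional of the residual with a functional of X S. By [mul_symkron] it is
    a trace whose two terms contain Q W S and S^T W Q^T, and both are 0. *)
Lemma residual_covariance0 (E : 'M[R]_n) (C : 'M[R]_(n, M)) :
  mxvec (Q^T *m E *m Q) *m symkron W *m (mxvec (C *m S^T))^T = 0.
Proof.
have QWS : Q *m W *m S = 0 := oblique_projectorWS G_unit.
have SWQ : S^T *m (W *m Q^T) = 0.
  by apply: trmx_inj; rewrite !trmx_mul !trmxK W_sym QWS trmx0.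
clearbody Q; rewrite -mulmxA mul_symkron [LHS]mx11_scalar mxvec_trace.
rewrite -!mulmxA mxtrace_mulC -!mulmxA.
rewrite [(_ *: _)^T]linearZ /= -[_ *: _ *m _]scalemxAl -scalemxAr.
rewrite !trmx_mul [(_ + _)^T]linearD /= !trmx_mul !trmxK W_sym.
rewrite !mulmxDr !mulmxDl mulmxDr !mulmxA QWS !mul0mx add0r -!mulmxA SWQ.
by rewrite !mulmx0 scaler0 mulmx0 mxtrace0 raddf0.
Qed.

(** The residual is Q (X - B0) Q^T, and its entry (i, j) is a trace pairing of X - B0 with
    [Q^T *m delta_mx i j *m Q]. *)
Lemma residual_coord (X : 'M[R]_n) (i j : 'I_n) : X^T = X ->
  mxvec X 0 (mxvec_index i j) -
    regression (mxvec (X *m S)) 0 (mxvec_index i j) =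
  ((mxvec X - mxvec B0) *m (mxvec (Q^T *m delta_mx i j *m Q))^T) 0 0.
Proof.
move=> X_sym; have D_sym : (X - B0)^T = X - B0 by rewrite linearB /= X_sym B0_sym.
transitivity ((Q *m (X - B0) *m Q^T) i j).
  rewrite -posterior_gain_congruence// regressionE !mxvecE posterior_meanE.
  by rewrite -mulmxBl !mxE opprD addrA.
have -> : mxvec X - mxvec B0 = mxvec (X - B0) by rewrite linearB.
rewrite mxvec_trace !trmx_mul trmxK !mulmxA mxtrace_mulC !mulmxA -mxvec_trace.
by rewrite mxvec_delta trmx_delta -colE [RHS]mxE mxvecE.
Qed.

Lemma posterior_mean_formula_gaussian (Y : 'M[R]_(n, M)) :
  gaussian_posterior_mean W B0 S Y (posterior_mean_formula W B0 S Y).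
Proof.
move=> d T P X X_sym X_gauss; exists regression.
split; [|exact: continuous_regression|exact: regressionE].
move=> p; set O := fun w => mxvec (X w *m S).
pose e := (mxvec (Q^T *m (vec_mx (delta_mx 0 p)) *m Q))^T.
pose U w := ((mxvec (X w) - mxvec B0) *m e) 0 0.
have UE w : U w = mxvec (X w) 0 p - regression (O w) 0 p.
  case/mxvec_indexP: p @e @U => i j.
  by rewrite vec_mx_delta => e U; rewrite residual_coord.
have Z_int : P.-integrable setT (EFin \o (fun w => mxvec (X w) 0 p)).
  have := gaussian_vector_integrable X_gauss (delta_mx p 0).
  by under eq_fun do rewrite -colE mxE.
have U_int : P.-integrable setT (EFin \o U).
  have UB w : U w = (mxvec (X w) *m e) 0 0 - (mxvec B0 *m e) 0 0.
    by rewrite /U mulmxBl !mxE.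
  rewrite (funext UB).
  exact: (integrableB measurableT (gaussian_vector_integrable X_gauss _)
    (finite_measure_integrable_cst _ _ measurableT)).
have regE w : regression (O w) 0 p = mxvec (X w) 0 p - U w.
  by rewrite UE opprB addrCA subrr addr0.
(* The affine functions of the observation contain its coordinates and are the arguments of the
   cosines. *)
pose L := [set v : T -> R | exists (c : 'cV[R]_(n * M)) (b : R),
  v = fun w => (O w *m c) 0 0 + b].
(* With C the matrix form of c, tr (X S C^T) = tr (X (C S^T)^T), so a functional of X S is one of
   X. *)
have OE w (c : 'cV_(n * M)) : (O w *m c) 0 0 =
    (mxvec (X w) *m (mxvec (vec_mx c^T *m S^T))^T) 0 0.
  rewrite -[c in LHS]trmxK -[c^T]vec_mxK !mxvec_trace trmx_mul trmxK mulmxA.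
  by rewrite vec_mxK.
have L_measurable v : L v -> measurable_fun setT v.
  move=> [c [b ->]]; apply: measurable_funD => //.
  by under eq_fun do rewrite OE; exact: gaussian_vector_measurable X_gauss _.
have L_cst r : L (fun=> r).
  by exists 0, r; apply/funext => w; rewrite mulmx0 mxE add0r.
have L_lin a u v : L u -> L v -> L (fun w => a * u w + v w).
  move=> [c [b ->]] [c' [b' ->]]; exists (a *: c + c'), (a * b + b').
  apply/funext => w; rewrite mulmxDr -scalemxAr [in RHS]mxE [X in _ = X + _ + _]mxE.
  by ring.
have cos_orth v : L v -> orthogonal_to P U (fun w => cos (v w)).
  move=> [c [b ->]]; under eq_fun do rewrite OE.
  apply: (gaussian_vector_orthogonal X_gauss); first exact: tr_symkron.
  by rewrite trmxK residual_covariance0.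
have L_O k : L (fun w => O w 0 k).
  by exists (delta_mx k 0), 0; apply/funext => w; rewrite addr0 -colE mxE.
split => //.
- under eq_fun do rewrite regE; exact: (integrableB measurableT Z_int U_int).
- move=> A mA.
  under [X in X @^-1` A]eq_fun do rewrite -/(O _) regression_coord.
  exact: g_sigma_preimage_affine.
(* The regression is the coordinate of X minus [U], and [U] integrates to 0 over [E]. *)
- move=> E /(integral_sigma_preimage0 U_int L_measurable L_cst L_lin cos_orth L_O).
  move=> [mE E0]; under eq_integral do rewrite regE EFinB.
  rewrite integralB_EFin// ?E0 ?sube0//; exact: integrableS (subsetT _) _.
Qed.

End Posterior.

Theorem lemma3p2 (R : realType) (N M : nat) (W : 'M[R]_N)
    (W_sym : W^T = W) (W_pd : posdefmx W) :
  (forall (B B0 : 'M[R]_N) (S Y : 'M[R]_(N, M)),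
     B^T = B -> B0^T = B0 -> \rank S = M -> Y = B *m S ->
     is_diag_mx (S^T *m W *m S) ->
     rank2_updates W S Y B0 = posterior_mean_formula W B0 S Y /\
     gaussian_posterior_mean W B0 S Y (rank2_updates W S Y B0)) /\
  (forall (H H0 : 'M[R]_N) (S Y : 'M[R]_(N, M)),
     H^T = H -> H0^T = H0 -> \rank Y = M -> S = H *m Y ->
     is_diag_mx (Y^T *m W *m Y) ->
     rank2_updates W Y S H0 = posterior_mean_formula W H0 Y S /\
     gaussian_posterior_mean W H0 Y S (rank2_updates W Y S H0)).
Proof.
have direct (B B0 : 'M[R]_N) (S Y : 'M[R]_(N, M)) :
    B^T = B -> B0^T = B0 -> \rank S = M -> Y = B *m S ->
    is_diag_mx (S^T *m W *m S) ->
    rank2_updates W S Y B0 = posterior_mean_formula W B0 S Y /\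
    gaussian_posterior_mean W B0 S Y (rank2_updates W S Y B0).
  move=> B_sym B0_sym rkS -> G_diag; rewrite (rank2_updatesE W_sym W_pd)//.
  split=> //; apply: posterior_mean_formula_gaussian => //.
  exact: gram_unitmx.
(* The inverse case is the direct one with [S] and [Y] exchanged and [H] in place of [B]. *)
by split=> [|H H0 S Y]; exact: direct.
Qed.
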